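(* Let $\mathcal{M}$ be a Global HopeDGN, mapping node pairs to $\mathbb{R}^d$. Let $\mathcal{DG}=\{\mathcal{V},\mathcal{E}\}$ and $\mathcal{DG}'=\{\mathcal{V}',\mathcal{E}'\}$ be two dynamic graphs with node features $\mathbf{X}$ and $\mathbf{X}'$. Suppose the 2-DWL test is initialized with a labeling $l$ of the node pairs of both graphs by natural numbers such that, for all $(u,v)\in[\mathcal{V}]^2$ and $(u',v')\in[\mathcal{V}']^2$, $l((u,v))=l((u',v'))$ if and only if $[\mathbf{X}_u\|\mathbf{X}_v]=[\mathbf{X}'_{u'}\|\mathbf{X}'_{v'}]$. If the functions $\mathrm{AGG}$, $\mathrm{UPDATE}$, $f_1$ and $f_2$ of $\mathcal{M}$ are injective, then at any time $t$, if the 2-DWL test assigns different colors to two node pairs, $\mathcal{M}$ also outputs different temporal embeddings of these two node pairs: for every $j\ge 0$, all $(u,v)\in[\mathcal{V}]^2$ and all $(u',v')\in[\mathcal{V}']^2$, $$c_t^{(j)}\big((u,v)\big)\ne c_t^{(j)}\big((u',v')\big)\ \Longrightarrow\ h_t^{(j)}\big((u,v)\big)\neq h_t^{(j)}\big((u',v')\big),$$ where $c_t^{(j)}$ is the 2-DWL color at iteration $j$ and $h_t^{(j)}$ is the $j$-th layer embedding of $\mathcal{M}$.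
   Context: Dynamic graph: $\mathcal{DG}=\{\mathcal{V},\mathcal{E}\}$ with $\mathcal{V}$ a finite node set and $\mathcal{E}=\{(u_1,v_1,t_1),(u_2,v_2,t_2),\dots\}$ a finite sequence of interactions with real timestamps $t_i\le t_{i+1}$; $(u_i,v_i,t_i)$ means nodes $u_i$ and $v_i$ interact at time $t_i$. Interactions are undirected, and the same pair may interact several times. Node features form a matrix $\mathbf{X}\in\mathbb{R}^{|\mathcal{V}|\times d_N}$ with row $\mathbf{X}_u$ for node $u$ (same $d_N$ for both graphs). $[\mathcal{V}]^2$ is the set of ordered pairs of nodes. Dynamic Adjacency Tensor (DAT): $\mathsf{A}$ is indexed by $\mathcal{V}\times\mathcal{V}\times\{1,\dots,T\}$, where $\mathsf{A}_{u,v,:}=[t_1,\dots,t_{q(u,v)},\infty,\dots,\infty]$ lists in nondecreasing order the timestamps of the $q(u,v)$ interactions between $u$ and $v$, padded by $\infty$ to length $T$. Thus $\mathsf{A}_{u,v,:}=\mathsf{A}_{v,u,:}$. $T$ is at least the maximum interaction count of any pair, and a common $T$ is used for the two graphs being compared. Historical DAT: $\mathsf{A}^{<t}_{i,j,k}=\mathsf{A}_{i,j,k}$ if $\mathsf{A}_{i,j,k}<t$, and $\infty$ otherwise. Time Interval Tensor: $\mathsf{B}^t_{i,j,k}=t-\mathsf{A}^{<t}_{i,j,k}$ if $\mathsf{A}^{<t}_{i,j,k}<t$, and $\infty$ otherwise. $\{\!\!\{\cdot\}\!\!\}$ denotes a multiset, $\|$ denotes concatenation; $\mathrm{HASH}$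 is an injective function of its arguments, the same for both graphs. 2-DWL test at time $t$: for $\mathbf{s}=(v_1,v_2)$, $c_t^{(0)}(\mathbf{s})=l(\mathbf{s})$ and for $j>0$ $$c_t^{(j)}(\mathbf{s})=\mathrm{HASH}\Big(c_t^{(j-1)}(\mathbf{s}),\ \{\!\!\{\big(c_t^{(j-1)}((w,v_2)),\,c_t^{(j-1)}((v_1,w)),\,\mathsf{A}^{<t}_{w,v_1,:},\,\mathsf{A}^{<t}_{w,v_2,:}\big): w\in\mathcal{V}\}\!\!\}\Big).$$ Global HopeDGN: given functions $\mathrm{UPDATE}$ (on pairs of vectors), $\mathrm{AGG}$ (on multisets of vectors), $f_1$ and $f_2$ (on vectors, entries of the argument of $f_2$ possibly $\infty$), all the same for both graphs and with outputs of fixed dimension, the embeddings of a node pair $\mathbf{s}=(u,v)$ at time $t$ are $h_t^{(0)}(\mathbf{s})=[\mathbf{X}_u\|\mathbf{X}_v]$ and for $l>0$ $$h_t^{(l)}(\mathbf{s})=\mathrm{UPDATE}\big(h_t^{(l-1)}(\mathbf{s}),\tilde h_t^{(l)}(\mathbf{s})\big),\qquad \tilde h_t^{(l)}(\mathbf{s})=\mathrm{AGG}\big(\{\!\!\{\psi_t(\mathbf{s},w): w\in\mathcal{V}\}\!\!\}\big),$$ $$\psi_t(\mathbf{s},w)=\Big[f_1\big([h_t^{(l-1)}((u,w))\,\|\,h_t^{(l-1)}((v,w))]\big)\ \Big\|\ f_2\big([\mathsf{B}^t_{u,w,:}\,\|\,\mathsf{B}^t_{v,w,:}]\big)\Big].$$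 Injectivity of $\mathrm{UPDATE}$ is as a function of the pair of its arguments, and of $\mathrm{AGG}$ as a function on multisets. *)

(* Defs.v *)
From mathcomp Require Import all_boot all_order all_algebra.
From mathcomp Require Import finmap multiset reals.

Set Implicit Arguments.
Unset Strict Implicit.
Unset Printing Implicit Defensive.

Import Order.TTheory GRing.Theory Num.Theory.
Local Open Scope mset_scope.
Local Open Scope ring_scope.

(* R together with +oo: [None] stands for +oo. Unlike \bar R, there is no -oo,
   hence no junk value on which injectivity would be required. *)
Notation xtime R := (option R).

Section DynamicGraph.
Variable R : realType.

(* Interactions are undirected: (u, v, t) and (v, u, t) mean the same thing,
   see [timestamps]. *)
Record dyngraph := Dyngraph {
  node : finType;
  events : seq (node * node * R);
  events_sorted : sorted (fun e f : node * node * R => e.2 <= f.2) events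
}.

Definition timestamps (G : dyngraph) (u v : node G) : seq R :=
  [seq e.2 | e <- events G & (e.1 == (u, v)) || (e.1 == (v, u))].

Lemma timestamps_sorted (G : dyngraph) (u v : node G) :
  sorted <=%R (timestamps u v).
Proof.
rewrite /timestamps sorted_map; apply: sorted_filter (events_sorted G).
by move=> x y z /le_trans; apply.
Qed.

Definition before (a : xtime R) (t : R) : bool :=
  if a is Some x then x < t else false.

(* [onth] returns [None] past the end of the list, which is the +oo padding. *)
Definition DAT (T : nat) (G : dyngraph) (u v : node G) : 'rV[xtime R]_T :=
  \row_(k < T) onth (timestamps u v) k.

Definition hDAT (T : nat) (G : dyngraph) (t : R) (u v : node G) :
    'rV[xtime R]_T :=
  \row_(k < T) (let a := DAT T u v 0 k in if before a t then a else None).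

(* [omap] only acts on finite entries, the only ones that can be before t. *)
Definition TIT (T : nat) (G : dyngraph) (t : R) (u v : node G) :
    'rV[xtime R]_T :=
  \row_(k < T) (let a := hDAT T t u v 0 k in
                if before a t then omap (fun x => t - x) a else None).

End DynamicGraph.

Section DWL.
Variables (R : realType) (T : nat) (C : choiceType).

Definition dwl_item : choiceType :=
  (C * C * 'rV[xtime R]_T * 'rV[xtime R]_T)%type.

(* Since timestamps are real, for T > 0 an injective HASH cannot take values in nat; the
   colors therefore form an arbitrary type C, into which the natural numbers
   used as initial labels are embedded by [color_of]. *)
Fixpoint dwl2 (HASH : C * {mset dwl_item} -> C) (color_of : nat -> C)
    (G : dyngraph R) (l : node G * node G -> nat) (t : R) (j : nat)
    (s : node G * node G) : C :=
  if j is j'.+1 then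
    let c := dwl2 HASH color_of l t j' in
    HASH (c s, seq_mset [seq ((c (w, s.2), c (s.1, w),
                               hDAT T t w s.1, hDAT T t w s.2) : dwl_item)
                        | w : node G])
  else color_of (l s).

End DWL.

(* The layer-0 embeddings have dimension dN + dN, the later ones dimension d,
   so UPDATE and f1 are families indexed by the dimension of their embedding
   argument. *)
Record hopedgn (R : realType) (T d : nat) := Hopedgn {
  dim1 : nat;
  dim2 : nat;
  dim_agg : nat;
  f1 : forall n : nat, 'rV[R]_n -> 'rV[R]_dim1;
  f2 : 'rV[xtime R]_(T + T) -> 'rV[R]_dim2;
  agg : {mset 'rV[R]_(dim1 + dim2)} -> 'rV[R]_dim_agg;
  update : forall n : nat, 'rV[R]_n * 'rV[R]_dim_agg -> 'rV[R]_d
}.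

Arguments f1 {R T d} M n _ : rename.
Arguments f2 {R T d} M _ : rename.
Arguments agg {R T d} M _ : rename.
Arguments update {R T d} M n _ : rename.

Section HopeDGN.
Variables (R : realType) (T d dN : nat) (M : hopedgn R T d).
Variables (G : dyngraph R) (X : 'M[R]_(#|node G|, dN)).

Definition feature (u : node G) : 'rV[R]_dN := row (enum_rank u) X.

Definition pair_feature (s : node G * node G) : 'rV[R]_(dN + dN) :=
  row_mx (feature s.1) (feature s.2).

Definition psi (t : R) (n : nat) (h : node G * node G -> 'rV[R]_n)
    (s : node G * node G) (w : node G) : 'rV[R]_(dim1 M + dim2 M) :=
  row_mx (f1 M _ (row_mx (h (s.1, w)) (h (s.2, w))))
         (f2 M (row_mx (TIT T t s.1 w) (TIT T t s.2 w))).

Definition layer (t : R) (n : nat) (h : node G * node G -> 'rV[R]_n)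
    (s : node G * node G) : 'rV[R]_d :=
  update M n (h s, agg M (seq_mset [seq psi t h s w | w : node G])).

End HopeDGN.

Definition emb_dim (d dN j : nat) : nat := if j is _.+1 then d else (dN + dN)%N.

Fixpoint embedding (R : realType) (T d dN : nat) (M : hopedgn R T d)
    (G : dyngraph R) (X : 'M[R]_(#|node G|, dN)) (t : R) (j : nat) :
    node G * node G -> 'rV[R]_(emb_dim d dN j) :=
  if j is j'.+1 then layer M t (embedding M X t j') else pair_feature X.

(* Main.v *)
Require Import Defs.
From mathcomp Require Import all_boot all_order all_algebra.
From mathcomp Require Import finmap multiset reals.

Set Implicit Arguments.
Unset Strict Implicit.
Unset Printing Implicit Defensive.

Local Open Scope mset_scope.
Local Open Scope ring_scope.

(** By contraposition and induction on [j], equal embeddings force equal colors. Injectivity of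
    [update] and [agg] recovers the previous embedding and the multiset of [psi] values. Each [psi]
    value determines the 2-DWL item of its node: [f1] yields colors by induction, and [f2] yields
    time intervals, hence timestamps ([hDAT_TIT]). So equal multisets of [psi] values give equal
    multisets of items ([perm_map_transfer]). *)

Lemma perm_map_transfer (I I' : Type) (A B : eqType) (f : I -> A) (f' : I' -> A)
    (g : I -> B) (g' : I' -> B) (r : seq I) (r' : seq I') :
  (forall x x', f x = f' x' -> g x = g' x') ->
  perm_eq (map f r) (map f' r') -> perm_eq (map g r) (map g' r').
Proof.
move=> fg; elim: r r' => [|x r IHr] r' /=.
  by case: r' => // x' r' /perm_size.
have split_at a (q : seq I') : a \in map f' q ->
    exists q1 x' q2, q = q1 ++ x' :: q2 /\ a = f' x'.
  elim: q => //= y q IHq; rewrite inE => /predU1P[->|/IHq[q1 [z [q2 [-> ->]]]]].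
    by exists [::], y, q.
  by exists (y :: q1), z, q2.
(* Pair the head [x] with some [x'] having the same [f]-value, hence the same [g]-value, and remove
   both. *)
move=> eq_f; have : f x \in map f' r' by rewrite -(perm_mem eq_f) mem_head.
move=> /split_at[q1 [x' [q2 [r'E fx]]]]; move: eq_f.
have pick_cons (D : eqType) (y : D) q q1' q2' :
    perm_eq (y :: q) (q1' ++ y :: q2') = perm_eq q (q1' ++ q2').
  by rewrite perm_sym (perm_catCA q1' [:: y]) perm_cons perm_sym.
rewrite {}r'E !map_cat /= fx (fg _ _ fx) !pick_cons -!map_cat.
exact: IHr.
Qed.

Lemma timestampsC (R : realType) (G : dyngraph R) (u v : node G) :
  timestamps u v = timestamps v u.
Proof. by rewrite /timestamps; under eq_filter do rewrite orbC. Qed.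

Lemma hDATC (R : realType) (T : nat) (G : dyngraph R) (t : R) (u v : node G) :
  hDAT T t u v = hDAT T t v u.
Proof. by rewrite /hDAT /DAT timestampsC. Qed.

(** Every finite entry of [hDAT] is before [t], so [TIT] applies the injective map x |-> t - x to
    each finite entry and fixes infinity. *)
Lemma hDAT_TIT (R : realType) (T : nat) (G G' : dyngraph R) (t : R)
    (u v : node G) (u' v' : node G') :
  TIT T t u v = TIT T t u' v' -> hDAT T t u v = hDAT T t u' v'.
Proof.
move=> /rowP eqB; apply/rowP => k; move: (eqB k); rewrite !mxE {eqB}.
have cut (a : xtime R) : let b := if before a t then a else None in
    (if before b t then omap (fun x => t - x) b else None) = omap (fun x => t - x) b.
  by case: ifP => //= ->.
by cbv zeta; rewrite !cut; apply: inj_omap => x y /GRing.addrI/GRing.oppr_inj.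
Qed.

Definition swap (A : Type) (s : A * A) : A * A := (s.2, s.1).

(* The 2-DWL items use [c (w, v)] where HopeDGN uses [h (v, w)]; equality of
   colors being stable under swapping makes the orientation immaterial. *)
Lemma dwl2_swap (R : realType) (T : nat) (G G' : dyngraph R)
    (C : choiceType) (color_of : nat -> C) (color_of_inj : injective color_of)
    (HASH : C * {mset dwl_item R T C} -> C) (HASH_inj : injective HASH)
    (l : node G * node G -> nat) (l' : node G' * node G' -> nat) (t : R)
    (l_swap : forall s s', l s = l' s' -> l (swap s) = l' (swap s'))
    (j : nat) (s : node G * node G) (s' : node G' * node G') :
  dwl2 HASH color_of l t j s = dwl2 HASH color_of l' t j s' ->
  dwl2 HASH color_of l t j (swap s) = dwl2 HASH color_of l' t j (swap s').
Proof.
elim: j s s' => [|j IHj] s s' /=; first by move/color_of_inj/l_swap ->.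
move=> /HASH_inj[/IHj-> /eq_seq_msetP eq_items].
congr (HASH (_, _)); apply/eq_seq_msetP.
(* The items of [swap s] carry the colors of the swapped pairs, in exchanged positions, so [IHj]
   applies to each. *)
apply: perm_map_transfer eq_items => w w' [/IHj eq_l /IHj eq_r eqA1 eqA2].
by congr (_, _, _, _).
Qed.

Theorem proposition5 (R : realType) (T d dN : nat) (M : hopedgn R T d)
    (G G' : dyngraph R)
    (X : 'M[R]_(#|node G|, dN)) (X' : 'M[R]_(#|node G'|, dN))
    (T_ge : forall u v : node G, (size (timestamps u v) <= T)%N)
    (T_ge' : forall u v : node G', (size (timestamps u v) <= T)%N)
    (C : choiceType) (color_of : nat -> C) (color_of_inj : injective color_of)
    (HASH : C * {mset dwl_item R T C} -> C) (HASH_inj : injective HASH)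
    (l : node G * node G -> nat) (l' : node G' * node G' -> nat)
    (l_feature : forall (s : node G * node G) (s' : node G' * node G'),
       l s = l' s' <-> pair_feature X s = pair_feature X' s')
    (agg_inj : injective (agg M))
    (update_inj : forall n : nat, injective (update M n))
    (f1_inj : forall n : nat, injective (f1 M n))
    (f2_inj : injective (f2 M))
    (t : R) (j : nat) (s : node G * node G) (s' : node G' * node G') :
  dwl2 HASH color_of l t j s <> dwl2 HASH color_of l' t j s' ->
  embedding M X t j s <> embedding M X' t j s'.
Proof.
apply: contra_not; elim: j s s' => [|j IHj] s s' /=.
  by move/l_feature ->.
move=> /update_inj[/IHj-> /agg_inj/eq_seq_msetP eq_psi].
congr (HASH (_, _)); apply/eq_seq_msetP.
apply: perm_map_transfer eq_psi => w w' /eq_row_mx[].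
move=> /f1_inj/eq_row_mx[/IHj eq_c1 /IHj eq_c2].
move=> /f2_inj/eq_row_mx[/hDAT_TIT eqA1 /hDAT_TIT eqA2].
(* The items index timestamps by [w] first, [psi] by [w] second; symmetry aligns them. What remains
   is the color of [(w, s.2)], known only for [(s.2, w)]. *)
rewrite !(hDATC _ _ w) !(hDATC _ _ w') eqA1 eqA2 eq_c1.
congr (_, _, _, _); apply: (dwl2_swap color_of_inj HASH_inj _ eq_c2).
(* Initial labels respect swapping because equal concatenations have equal halves. *)
move=> p p' /l_feature/eq_row_mx[eq1 eq2]; apply/l_feature.
by rewrite /pair_feature eq1 eq2.
Qed.
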